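(* $$\frac{2}{2\zeta(5)+6\zeta(3)-9}=\mathrm{CF}\left[n^5+(n+1)^5+6\{n^3+(n+1)^3\},\,-n^{10}\right].$$
   Context: For sequences $(a_n)_{n\ge0}$, $(b_n)_{n\ge1}$, $\mathrm{CF}[a_n,b_n]$ denotes the continued fraction $a_0+\cfrac{b_1}{a_1+\cfrac{b_2}{a_2+\ddots}}$, whose value is $\lim_{n\to\infty}A_n/B_n$, where $A_0=1$, $A_1=a_0$, $B_0=0$, $B_1=1$, and $A_{n+1}=a_nA_n+b_nA_{n-1}$, $B_{n+1}=a_nB_n+b_nB_{n-1}$ for $n\ge1$. $\zeta$ is the Riemann zeta function. *)

(* Defs.v *)
From Stdlib Require Import Reals.
From Coquelicot Require Import Coquelicot.
Open Scope R_scope.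

(* Riemann zeta by its Dirichlet series: the right value only for s > 1. *)
Definition zeta (s : R) : R :=
  Series (fun n : nat => Rpower (INR (S n)) (- s)).

(* A_0 = 1, A_1 = a_0, A_{n+1} = a_n A_n + b_n A_{n-1}; b_0 is never used. *)
Fixpoint cf_num (a b : nat -> R) (n : nat) {struct n} : R :=
  match n with
  | O => 1
  | S m => match m with
           | O => a O
           | S k => a m * cf_num a b m + b m * cf_num a b k
           end
  end.

(* B_0 = 0, B_1 = 1, B_{n+1} = a_n B_n + b_n B_{n-1}. *)
Fixpoint cf_den (a b : nat -> R) (n : nat) {struct n} : R :=
  match n with
  | O => 0
  | S m => match m with
           | O => 1
           | S k => a m * cf_den a b m + b m * cf_den a b k
           end
  end.

(* B_0 = 0, so only the quotients A_n / B_n for large n are required to be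
   genuine; without the first conjunct, infinitely many of them could be the
   arbitrary values of a division by zero. *)
Definition is_CF (a b : nat -> R) (l : R) : Prop :=
  eventually (fun n => cf_den a b n <> 0) /\
  is_lim_seq (fun n => cf_num a b n / cf_den a b n) (Finite l).

(* Main.v *)
(* The numerators are A_n = (n!)^5 p_n with p_n = 3n^2 + 3n + 1, and the
   Casoratian of (A_n) and (B_n) is (n!)^10, so B_n / A_n telescopes to the sum
   over 1 <= k <= n of 1 / (k^5 p_{k-1} p_k).  Since p_{k-1} p_k = 9k^4 - 3k^2 + 1
   and (1 + 3k^2) (9k^4 - 3k^2 + 1) = 1 + 27k^6, each term equals
   1/k^5 + 3/k^3 - (9/2) (1/p_{k-1} - 1/p_k), whence
   B_n / A_n -> zeta(5) + 3 zeta(3) - 9/2. *)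
Require Import Defs.
From Stdlib Require Import Reals Factorial Lra Lia.
From Coquelicot Require Import Coquelicot.
Open Scope R_scope.

Definition zeta53_a (n : nat) : R :=
  INR n ^ 5 + (INR n + 1) ^ 5 + 6 * (INR n ^ 3 + (INR n + 1) ^ 3).

Definition zeta53_b (n : nat) : R := - INR n ^ 10.

Definition zeta53_p (n : nat) : R := 3 * INR n ^ 2 + 3 * INR n + 1.

(** The index is shifted by one: this is the summand for k = n + 1. *)
Definition zeta53_term (n : nat) : R :=
  / ((INR n + 1) ^ 5 * zeta53_p n * zeta53_p (S n)).

Lemma two_step_ind (P : nat -> Prop) :
  P O -> P 1%nat -> (forall n, P n -> P (S n) -> P (S (S n))) -> forall n, P n.
Proof.
intros H0 H1 H n.
enough (P n /\ P (S n)) by easy.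
induction n as [|n [IH1 IH2]]; auto.
Qed.

Lemma cf_num_SS (a b : nat -> R) (n : nat) :
  cf_num a b (S (S n)) =
  a (S n) * cf_num a b (S n) + b (S n) * cf_num a b n.
Proof. reflexivity. Qed.

Lemma cf_den_SS (a b : nat -> R) (n : nat) :
  cf_den a b (S (S n)) =
  a (S n) * cf_den a b (S n) + b (S n) * cf_den a b n.
Proof. reflexivity. Qed.

Lemma INR_fact_S (n : nat) : INR (fact (S n)) = (INR n + 1) * INR (fact n).
Proof. now rewrite fact_simpl, mult_INR, S_INR. Qed.

Lemma zeta53_p_pos (n : nat) : 0 < zeta53_p n.
Proof. unfold zeta53_p. pose proof (pos_INR n). nra. Qed.

Lemma zeta53_term_pos (n : nat) : 0 < zeta53_term n.
Proof.
apply Rinv_0_lt_compat.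
pose proof (pos_INR n).
apply Rmult_lt_0_compat; [apply Rmult_lt_0_compat |]; try apply zeta53_p_pos.
apply pow_lt; lra.
Qed.

(** Divided by (m!)^5, the recurrence becomes the polynomial identity (m+1)^5 p_{m+1} + m^5 p_{m-1}
    = a_m p_m with m = n + 1. *)
Lemma cf_num_zeta53 (n : nat) :
  cf_num zeta53_a zeta53_b n = INR (fact n) ^ 5 * zeta53_p n.
Proof.
induction n as [| |n IH1 IH2] using two_step_ind.
- unfold zeta53_p; simpl; ring.
- unfold zeta53_p, zeta53_a; simpl; ring.
- rewrite cf_num_SS, IH1, IH2, !INR_fact_S.
  unfold zeta53_a, zeta53_b, zeta53_p.
  rewrite !S_INR. ring.
Qed.

Lemma cf_num_zeta53_pos (n : nat) : 0 < cf_num zeta53_a zeta53_b n.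
Proof.
rewrite cf_num_zeta53.
apply Rmult_lt_0_compat; [apply pow_lt, INR_fact_lt_0 | apply zeta53_p_pos].
Qed.

Lemma zeta53_term_casoratian (n : nat) :
  cf_num zeta53_a zeta53_b n * cf_num zeta53_a zeta53_b (S n) * zeta53_term n =
  INR (fact n) ^ 10.
Proof.
rewrite !cf_num_zeta53, INR_fact_S.
unfold zeta53_term.
pose proof (pos_INR n).
field.
repeat split; try (apply Rgt_not_eq, zeta53_p_pos); lra.
Qed.

(** Each [zeta53_term n] is the increment B_{n+1}/A_{n+1} - B_n/A_n. The sum starts from B_0/A_0 =
    0, hence the shift to [S n]. *)
Lemma cf_den_zeta53 (n : nat) :
  cf_den zeta53_a zeta53_b (S n) = cf_num zeta53_a zeta53_b (S n) * sum_n zeta53_term n.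
Proof.
induction n as [| |n IH1 IH2] using two_step_ind.
- rewrite sum_O, cf_num_zeta53. unfold zeta53_term, zeta53_p. simpl. field.
- rewrite sum_Sn, sum_O, !cf_num_zeta53.
  unfold plus, zeta53_term, zeta53_a, zeta53_b, zeta53_p. simpl.
  unfold zeta53_a, zeta53_b. simpl. field.
- rewrite cf_den_SS, IH1, IH2, !sum_Sn.
  (* After the sums are split, this is all that the recurrence for B still requires. Multiplied by
     A_{n+2}, both sides become ((n+2)!)^10 by the Casoratian identity. *)
  assert (E : cf_num zeta53_a zeta53_b (S (S (S n))) * zeta53_term (S (S n)) =
    - (zeta53_b (S (S n)) * cf_num zeta53_a zeta53_b (S n) * zeta53_term (S n))).
  { apply (Rmult_eq_reg_l (cf_num zeta53_a zeta53_b (S (S n)))).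
    - transitivity (INR (fact (S (S n))) ^ 10).
      + rewrite <- zeta53_term_casoratian. ring.
      + transitivity (- zeta53_b (S (S n)) * INR (fact (S n)) ^ 10).
        * rewrite (INR_fact_S (S n)). unfold zeta53_b. rewrite (S_INR (S n)). ring.
        * rewrite <- zeta53_term_casoratian. ring.
    - apply Rgt_not_eq, cf_num_zeta53_pos. }
  change plus with Rplus.
  rewrite (Rmult_plus_distr_l (cf_num _ _ (S (S (S n))))), E, (cf_num_SS _ _ (S n)).
  ring.
Qed.

(** [Series] is total, so [zeta] is known to be the sum only once convergence is proved. *)
Lemma zeta_nat_series (k : nat) :
  (2 <= k)%nat -> is_series (fun n => / (INR n + 1) ^ k) (zeta (INR k)).
Proof.
intros Hk.
assert (Hterm : forall n, Rpower (INR (S n)) (- INR k) = / (INR n + 1) ^ k).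
{ intros n. pose proof (pos_INR n).
  rewrite Rpower_Ropp, Rpower_pow, S_INR; [reflexivity | rewrite S_INR; lra]. }
unfold zeta.
rewrite (Series_ext _ _ Hterm).
apply Series_correct.
(* The majorant is 2/((n+1)(n+2)), which telescopes; it dominates 1/(n+1)^2 because n + 2 <=
   2(n+1). *)
apply (ex_series_le (V := R_CompleteNormedModule)
         _ (fun n => 2 * (/ (INR n + 1) - / (INR (S n) + 1)))).
- intros n. change norm with Rabs.
  pose proof (pos_INR n).
  assert (0 < / (INR n + 1) ^ k) by (apply Rinv_0_lt_compat, pow_lt; lra).
  rewrite Rabs_pos_eq by lra.
  apply Rle_trans with (/ (INR n + 1) ^ 2).
  + apply Rinv_le_contravar; [apply pow_lt; lra | apply Rle_pow; [lra | lia]].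
  + rewrite S_INR.
    replace (2 * _) with (/ ((INR n + 1) * (INR n + 2) / 2)) by (field; lra).
    apply Rinv_le_contravar; nra.
- apply (ex_series_scal (V := R_NormedModule) 2).
  exists 1.
  change (is_lim_seq (sum_n (fun n => / (INR n + 1) - / (INR (S n) + 1))) 1).
  apply (is_lim_seq_ext (fun n => 1 - / INR (S (S n)))).
  + intros n. induction n as [|n IH].
    * rewrite sum_O. simpl. field.
    * rewrite sum_Sn, <- IH. change plus with Rplus.
      rewrite !S_INR. pose proof (pos_INR n). field. lra.
  + replace (Finite 1) with (Finite (1 - 0)) by (f_equal; ring).
    apply is_lim_seq_minus'; [apply is_lim_seq_const |].
    apply (is_lim_seq_incr_1 (fun n => / INR (S n))).
    apply (is_lim_seq_incr_1 (fun n => / INR n)).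
    replace (Finite 0) with (Rbar_inv p_infty) by reflexivity.
    apply is_lim_seq_inv; [apply is_lim_seq_INR | easy].
Qed.

Lemma zeta53_p_inv_lim : is_lim_seq (fun n => / zeta53_p n) 0.
Proof.
apply (is_lim_seq_inv _ p_infty); [| easy].
apply (is_lim_seq_le_p_loc INR); [| apply is_lim_seq_INR].
exists O. intros n _. unfold zeta53_p. pose proof (pos_INR n). nra.
Qed.

(** Termwise partial fractions; the differences of reciprocals telescope, and the 1 is 1/p_0. *)
Lemma sum_zeta53_term (n : nat) :
  sum_n zeta53_term n =
  sum_n (fun k => / (INR k + 1) ^ 5) n + 3 * sum_n (fun k => / (INR k + 1) ^ 3) n
  - 9 / 2 * (1 - / zeta53_p (S n)).
Proof.
induction n as [|n IH].
- rewrite !sum_O. unfold zeta53_term, zeta53_p. simpl. field.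
- rewrite !sum_Sn, IH. change plus with Rplus.
  assert (E : zeta53_term (S n) =
    / (INR (S n) + 1) ^ 5 + 3 * / (INR (S n) + 1) ^ 3
    - 9 / 2 * (/ zeta53_p (S n) - / zeta53_p (S (S n)))).
  { pose proof (zeta53_p_pos (S n)) as H1. pose proof (zeta53_p_pos (S (S n))) as H2.
    pose proof (pos_INR (S n)).
    unfold zeta53_term, zeta53_p in *. rewrite (S_INR (S n)) in *.
    field. repeat split; lra. }
  rewrite E.
  (* The equality lives in the carrier returned by [sum_n]; it is restated over [R] for [ring]. *)
  match goal with |- ?x = ?y => change (@eq R x y) end.
  ring.
Qed.

Lemma zeta53_series : is_series zeta53_term (zeta 5 + 3 * zeta 3 - 9 / 2).
Proof.
change (is_lim_seq (sum_n zeta53_term) (zeta 5 + 3 * zeta 3 - 9 / 2)).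
apply (is_lim_seq_ext _ _ _ (fun n => eq_sym (sum_zeta53_term n))).
replace (zeta 5 + 3 * zeta 3 - 9 / 2)
  with (zeta 5 + 3 * zeta 3 - 9 / 2 * (1 - 0)) by field.
replace (zeta 5) with (zeta (INR 5)) by (f_equal; simpl; ring).
replace (zeta 3) with (zeta (INR 3)) by (f_equal; simpl; ring).
apply is_lim_seq_minus'; [apply is_lim_seq_plus' |].
- apply (zeta_nat_series 5). lia.
- apply (is_lim_seq_scal_l _ 3 (zeta (INR 3))).
  apply (zeta_nat_series 3). lia.
- apply (is_lim_seq_scal_l _ (9 / 2) (1 - 0)).
  apply is_lim_seq_minus'; [apply is_lim_seq_const |].
  apply (is_lim_seq_incr_1 (fun n => / zeta53_p n)), zeta53_p_inv_lim.
Qed.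

(** The terms are positive and the first is 1/(p_0 p_1) = 1/7. *)
Lemma sum_zeta53_term_ge (n : nat) : / 7 <= sum_n zeta53_term n.
Proof.
induction n as [|n IH].
- rewrite sum_O. unfold zeta53_term, zeta53_p. simpl. right. field.
- rewrite sum_Sn. change plus with Rplus.
  pose proof (zeta53_term_pos (S n)). lra.
Qed.

Theorem theorem3p4 :
  is_CF
    (fun n : nat =>
       INR n ^ 5 + (INR n + 1) ^ 5 + 6 * (INR n ^ 3 + (INR n + 1) ^ 3))
    (fun n : nat => - INR n ^ 10)
    (2 / (2 * zeta 5 + 6 * zeta 3 - 9)).
Proof.
change (is_CF zeta53_a zeta53_b (2 / (2 * zeta 5 + 6 * zeta 3 - 9))).
(* A uniform bound, unlike mere positivity of the partial sums, passes to the limit and makes it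
   invertible. *)
assert (HL : / 7 <= zeta 5 + 3 * zeta 3 - 9 / 2).
{ apply (is_lim_seq_le (fun _ => / 7) (sum_n zeta53_term) (/ 7)
           (zeta 5 + 3 * zeta 3 - 9 / 2)).
  - exact sum_zeta53_term_ge.
  - apply is_lim_seq_const.
  - exact zeta53_series. }
split.
- exists 1%nat. intros [|n] Hn; [lia |].
  rewrite cf_den_zeta53.
  pose proof (sum_zeta53_term_ge n).
  apply Rgt_not_eq, Rmult_lt_0_compat; [apply cf_num_zeta53_pos | lra].
(* Dropping the index 0, where B_0 = 0, leaves A_{n+1}/B_{n+1} as the inverse of the n-th partial
   sum. *)
- apply is_lim_seq_incr_1.
  apply (is_lim_seq_ext (fun n => / sum_n zeta53_term n)).
  + intros n. rewrite cf_den_zeta53.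
    pose proof (sum_zeta53_term_ge n).
    pose proof (cf_num_zeta53_pos (S n)).
    field. split; lra.
  + replace (2 / (2 * zeta 5 + 6 * zeta 3 - 9))
      with (/ (zeta 5 + 3 * zeta 3 - 9 / 2)) by (field; lra).
    apply (is_lim_seq_inv _ (zeta 5 + 3 * zeta 3 - 9 / 2)).
    * exact zeta53_series.
    * intros H. injection H. lra.
Qed.
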